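(* Let $b>0$. Then the operator norm of the generalized Hilbert operator $\mathcal{H}_b$ from $H^\infty$ to the Bloch space $\mathcal{B}$ is $$\|\mathcal{H}_b\|_{H^\infty\to\mathcal{B}}=\frac{1}{b+1}+2.$$
   Context: $\mathbb{D}=\{z\in\mathbb{C}:|z|<1\}$. $H^\infty$ is the space of bounded analytic functions on $\mathbb{D}$ with $\|f\|_{H^\infty}=\sup_{z\in\mathbb{D}}|f(z)|$. The Bloch space $\mathcal{B}$ consists of all analytic functions $f$ on $\mathbb{D}$ with $\|f\|_{\mathcal{B}}:=|f(0)|+\sup_{z\in\mathbb{D}}(1-|z|^2)|f'(z)|<\infty$. For $b>0$, the generalized Hilbert operator is $$\mathcal{H}_b f(z)=\int_0^1 f(t)\,\frac{(1-t)^b}{(1-tz)^{b+1}}\,dt,\qquad z\in\mathbb{D}.$$ For normed spaces $X,Y$, $\|\mathcal{H}_b\|_{X\to Y}=\sup\{\|\mathcal{H}_bf\|_Y: f\in X,\ \|f\|_X\le 1\}$. *)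

(* Defs.v *)
From Stdlib Require Import Reals.
From Coquelicot Require Import Coquelicot.
Open Scope R_scope.

(* A function on the unit disk is represented by a total function [C -> C];
   no definition below depends on its values outside the disk. *)
Definition disk (z : C) : Prop := Cmod z < 1.

(* Differentiability is over the field C, i.e. complex differentiability. *)
Definition analytic_on_disk (f : C -> C) : Prop :=
  forall z : C, disk z -> ex_derive (K := C_AbsRing) (V := C_NormedModule) f z.

(* Norms take values in the extended reals and are infinite exactly when the
   supremum defining them is. *)
Definition Hinf_norm (f : C -> C) : Rbar :=
  Lub_Rbar (fun x : R => exists z : C, disk z /\ x = Cmod (f z)).

Definition Hinf (f : C -> C) : Prop :=
  analytic_on_disk f /\ Rbar_lt (Hinf_norm f) p_infty.

Definition Bloch_norm (f : C -> C) : Rbar :=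
  Rbar_plus (Finite (Cmod (f (RtoC 0))))
    (Lub_Rbar (fun x : R => exists z : C,
       disk z /\ x = (1 - Cmod z ^ 2) * Cmod (C_derive f z))).

Definition Bloch (f : C -> C) : Prop :=
  analytic_on_disk f /\ Rbar_lt (Bloch_norm f) p_infty.

Definition Cexp (w : C) : C :=
  (exp (Re w) * cos (Im w), exp (Re w) * sin (Im w)).

(* Principal argument, in (-PI, PI]; [Arg 0 = 0] is a dummy value. *)
Definition Arg (w : C) : R :=
  if Rlt_dec 0 (Re w) then atan (Im w / Re w)
  else if Rlt_dec (Re w) 0 then
    (if Rle_dec 0 (Im w) then atan (Im w / Re w) + PI
     else atan (Im w / Re w) - PI)
  else if Rlt_dec 0 (Im w) then PI / 2
  else if Rlt_dec (Im w) 0 then - (PI / 2)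
  else 0.

Definition Clog (w : C) : C := (ln (Cmod w), Arg w).

(* Principal branch of [w ^ a], meaningful for [w <> 0]. *)
Definition Cpower (w : C) (a : R) : C := Cexp (RtoC a * Clog w)%C.

(* Improper at 1, since [f] need not be defined there.  For [z] in the disk and
   [0 <= t < 1], [1 - t * z] has positive real part, so the principal branch is
   the analytic one, and [Rpower] is applied to a positive base. *)
Definition Hilbert_op (b : R) (f : C -> C) (z : C) : C :=
  RInt_gen (V := C_R_CompleteNormedModule)
    (fun t : R =>
       (f (RtoC t) *
        (RtoC (Rpower (1 - t) b) /
         Cpower (RtoC 1 - RtoC t * z) (b + 1)))%C)
    (at_point 0) (at_left 1).

Definition operator_norm (X : (C -> C) -> Prop)
    (normX normY : (C -> C) -> Rbar) (T : (C -> C) -> (C -> C)) : Rbar :=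
  Rbar_lub (fun y : Rbar => exists f : C -> C,
    X f /\ Rbar_le (normX f) (Finite 1) /\ y = normY (T f)).

(* Main.v *)
Require Import Defs.
From Stdlib Require Import Reals Lra Psatz.
From Coquelicot Require Import Coquelicot.
Open Scope R_scope.

(** Write [H] for the operator and [r = |z|].  Since [b > 0], the factor
    [(1-t)^b] kills the possible discontinuity of a bounded [f] at [t = 1], so
    [H f z] is the ordinary integral over [0,1] of a continuous function
    ([Hilbert_op_eq_Cint]), and one may differentiate under the integral sign
    ([is_derive_Hilbert_op]):
      [(H f)'(z) = (b+1) * int_0^1 t f(t) (1-t)^b (1-tz)^{-(b+2)} dt].

    Everything then rests on one exact integral ([is_RInt_weight]):
      [(b+1) * int_0^1 (1-t)^b (1-tr)^{-(b+2)} dt = 1/(1-r)],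
    valid because [((1-t)/(1-tr))^{b+1}] has derivative
    [-(b+1)(1-r) (1-t)^b (1-tr)^{-(b+2)}].

    Upper bound.  If [|f| <= M] on the disk, then [|1-tz| >= 1-tr] and [t <= 1]
    give [|(H f)'(z)| <= M/(1-r)], hence [(1-r^2)|(H f)'(z)| <= M(1+r) <= 2M];
    the case [r = 0] of the integral gives [|H f(0)| <= M/(b+1)].

    Lower bound.  The constant function 1 attains [|H f(0)| = 1/(b+1)].  For it,
    the factor [t] in the derivative costs nothing as [z = r] tends to 1 along
    the reals, because the mass of the kernel concentrates at [t = 1].  Taking
    [r = 1 - s^2] and cutting at [t = 1 - s] gives
    [(1-r^2)(H 1)'(r) >= (2-s^2)(1-(b+2)s)], which tends to 2 with [s -> 0]
    ([weight_lower_bound], [Hilbert_op_one_seminorm_ge]).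

    Differentiation under the integral uses a second-order Taylor estimate for
    the principal power, uniform on [Re w >= d] ([Cpower_taylor]).  It is
    obtained from derivatives along real segments only, which are computed on
    real and imaginary parts. *)

(** * Powers extended by zero and the exact weight integral *)

(** [Rpower 0 a] is 1 because [ln 0 = 0] by convention; here the value at 0, and
    below, is 0, so that for [a > 0] the function is continuous everywhere and
    integrals of [(1-t)^b] need no improper treatment at [t = 1]. *)
Definition vanishing_power (x a : R) : R :=
  if Rlt_dec 0 x then Rpower x a else 0.

Lemma vanishing_power_pos x a : 0 < x -> vanishing_power x a = Rpower x a.
Proof. intros Hx; unfold vanishing_power; destruct (Rlt_dec 0 x); lra. Qed.

Lemma vanishing_power_npos x a : x <= 0 -> vanishing_power x a = 0.
Proof. intros Hx; unfold vanishing_power; destruct (Rlt_dec 0 x); lra. Qed.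

Lemma vanishing_power_ge0 x a : 0 <= vanishing_power x a.
Proof.
  unfold vanishing_power; destruct (Rlt_dec 0 x); [left; apply exp_pos | lra].
Qed.

Lemma vanishing_power_succ x a :
  0 <= x -> vanishing_power x (a + 1) = x * vanishing_power x a.
Proof.
  intros Hx; unfold vanishing_power; destruct (Rlt_dec 0 x) as [Hp|]; [|lra].
  rewrite Rpower_plus, Rpower_1 by exact Hp; ring.
Qed.

Lemma vanishing_power_small a eps :
  0 < a -> 0 < eps ->
  exists d : posreal, forall x, Rabs x < d -> vanishing_power x a < eps.
Proof.
  intros Ha He.
  assert (Hd : 0 < Rpower eps (/ a)) by apply exp_pos.
  (* The radius solves [x^a = eps]. *)
  exists (mkposreal _ Hd); simpl; intros x Hx.
  destruct (Rlt_dec 0 x) as [Hp|Hn].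
  - rewrite vanishing_power_pos by exact Hp.
    rewrite Rabs_pos_eq in Hx by lra.
    replace eps with (Rpower (Rpower eps (/ a)) a).
    + apply Rlt_Rpower_l; lra.
    + rewrite Rpower_mult, Rinv_l, Rpower_1; lra.
  - rewrite vanishing_power_npos; lra.
Qed.

Lemma locally_pos x : 0 < x -> locally x (fun y => 0 < y).
Proof. intros Hx; exact (open_gt 0 x Hx). Qed.

Lemma locally_neg x : x < 0 -> locally x (fun y => y < 0).
Proof. intros Hx; exact (open_lt 0 x Hx). Qed.

Lemma is_derive_Rpower_pos a x :
  0 < x -> is_derive (fun y => Rpower y a) x (a * Rpower x (a - 1)).
Proof.
  intros Hx; apply is_derive_Reals, derivable_pt_lim_power, Hx.
Qed.

Lemma is_derive_vanishing_power_nonzero a x :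
  x <> 0 ->
  is_derive (fun y => vanishing_power y a) x (a * vanishing_power x (a - 1)).
Proof.
  intros Hx; destruct (Rlt_dec 0 x) as [Hp|Hn].
  - rewrite (vanishing_power_pos x) by exact Hp.
    apply is_derive_ext_loc with (2 := is_derive_Rpower_pos a x Hp).
    apply filter_imp with (2 := locally_pos x Hp).
    intros y Hy; symmetry; apply vanishing_power_pos, Hy.
  - rewrite (vanishing_power_npos x), Rmult_0_r by lra.
    apply is_derive_ext_loc with (2 := is_derive_const 0 x).
    apply filter_imp with (2 := locally_neg x ltac:(lra)).
    intros y Hy; symmetry; apply vanishing_power_npos; lra.
Qed.

Lemma continuous_vanishing_power a x :
  0 < a -> continuous (fun y => vanishing_power y a) x.
Proof.
  intros Ha; destruct (Req_dec x 0) as [->|Hx].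
  - apply filterlim_locally; intros eps.
    destruct (vanishing_power_small a eps Ha (cond_pos eps)) as [d Hd].
    exists d; intros y Hy.
    change (Rabs (y - 0) < d) in Hy; rewrite Rminus_0_r in Hy.
    change (Rabs (vanishing_power y a - vanishing_power 0 a) < eps).
    rewrite (vanishing_power_npos 0), Rminus_0_r by lra.
    rewrite Rabs_pos_eq by apply vanishing_power_ge0; auto.
  - apply (ex_derive_continuous (fun y => vanishing_power y a)).
    eexists; apply is_derive_vanishing_power_nonzero, Hx.
Qed.

(** At 0 the difference quotient is [h^(a-1)] or 0, which tends to 0 exactly
    because [a > 1].  This makes the fundamental theorem of calculus applicable
    up to the endpoint. *)
Lemma is_derive_vanishing_power a x :
  1 < a ->
  is_derive (fun y => vanishing_power y a) x (a * vanishing_power x (a - 1)).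
Proof.
  intros Ha; destruct (Req_dec x 0) as [->|Hx];
    [|apply is_derive_vanishing_power_nonzero, Hx].
  rewrite (vanishing_power_npos 0), Rmult_0_r by lra.
  apply is_derive_Reals; intros eps He.
  destruct (vanishing_power_small (a - 1) eps ltac:(lra) He) as [d Hd].
  exists d; intros h Hh Hhd.
  rewrite Rplus_0_l, (vanishing_power_npos 0), !Rminus_0_r by lra.
  destruct (Rlt_dec 0 h) as [Hp|Hn].
  - replace a with (a - 1 + 1) by ring.
    rewrite vanishing_power_succ by lra.
    replace (h * vanishing_power h (a - 1) / h) with (vanishing_power h (a - 1))
      by (field; exact Hh).
    rewrite Rabs_pos_eq by apply vanishing_power_ge0; auto.
  - rewrite vanishing_power_npos by lra.
    unfold Rdiv; rewrite Rmult_0_l, Rabs_R0; exact He.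
Qed.

Lemma one_sub_mul_pos t r : 0 <= t <= 1 -> 0 <= r < 1 -> 0 < 1 - t * r.
Proof. nra. Qed.

(** A primitive of the integrand is a multiple of
    [((1-t)/(1-tr))^(b+1)], which goes from 1 to 0. *)
Lemma is_RInt_weight b r :
  0 < b -> 0 <= r < 1 ->
  is_RInt (fun t => vanishing_power (1 - t) b * Rpower (1 - t * r) (- (b + 2)))
    0 1 (/ ((b + 1) * (1 - r))).
Proof.
  intros Hb Hr.
  pose (G := fun t => vanishing_power (1 - t) (b + 1)
                      * Rpower (1 - t * r) (- (b + 1))).
  pose (c := - / ((b + 1) * (1 - r))).
  pose (g := fun t =>
    vanishing_power (1 - t) b * Rpower (1 - t * r) (- (b + 2))).
  assert (H : is_RInt g 0 1 (minus (scal c (G 1)) (scal c (G 0)))).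
  { apply (is_RInt_derive (fun t => scal c (G t)));
      intros t; rewrite Rmin_left, Rmax_right by lra; intros Ht;
      pose proof (one_sub_mul_pos t r Ht Hr) as Hpos.
    - assert (HG : is_derive G t (- (b + 1) * (1 - r) * g t)).
      { assert (H1 : is_derive (fun t => vanishing_power (1 - t) (b + 1)) t
          (-1 * ((b + 1) * vanishing_power (1 - t) (b + 1 - 1)))).
        { apply (is_derive_comp (fun y => vanishing_power y (b + 1))
                                (fun t => 1 - t)).
          - apply is_derive_vanishing_power; lra.
          - auto_derive; [exact I | ring]. }
        assert (H2 : is_derive (fun t => Rpower (1 - t * r) (- (b + 1))) t
          (- r * (- (b + 1) * Rpower (1 - t * r) (- (b + 1) - 1)))).
        { apply (is_derive_comp (fun y => Rpower y (- (b + 1)))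
                                (fun t => 1 - t * r)).
          - apply is_derive_Rpower_pos, Hpos.
          - auto_derive; [exact I | ring]. }
        pose proof (is_derive_mult _ _ _ _ _ H1 H2 Rmult_comm) as H3.
        unfold G; apply (is_derive_ext _ _ _ _ (fun t => eq_refl)) in H3.
        match goal with |- is_derive _ _ ?v =>
          match type of H3 with is_derive _ _ ?u => replace v with u end end.
        + exact H3.
        + unfold plus, mult, g; simpl.
          replace (b + 1 - 1) with b by ring.
          replace (- (b + 1) - 1) with (- (b + 2)) by ring.
          replace (- (b + 1)) with (- (b + 2) + 1) at 1 by ring.
          rewrite (Rpower_plus (- (b + 2)) 1), Rpower_1 by exact Hpos.
          rewrite vanishing_power_succ by lra; ring. }
      replace (g t) with (scal c (- (b + 1) * (1 - r) * g t)).
      + exact (is_derive_scal G t c _ HG).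
      + unfold scal, c; simpl; unfold mult; simpl; field; lra.
    - apply (continuous_mult (fun t => vanishing_power (1 - t) b)
               (fun t => Rpower (1 - t * r) (- (b + 2)))).
      + apply (continuous_comp (fun t => 1 - t)
                 (fun y => vanishing_power y b)).
        * apply (ex_derive_continuous (fun t => 1 - t)); auto_derive; exact I.
        * apply continuous_vanishing_power, Hb.
      + apply (continuous_comp (fun t => 1 - t * r)
                 (fun y => Rpower y (- (b + 2)))).
        * apply (ex_derive_continuous (fun t => 1 - t * r)); auto_derive; exact I.
        * apply (ex_derive_continuous (fun y => Rpower y (- (b + 2)))).
          eexists; apply is_derive_Rpower_pos, Hpos. }
  replace (/ ((b + 1) * (1 - r))) with (minus (scal c (G 1)) (scal c (G 0)));
    [exact H|].
  unfold minus, plus, opp, scal, G; simpl; unfold mult; simpl.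
  rewrite (vanishing_power_npos (1 - 1)) by lra.
  rewrite vanishing_power_pos by lra.
  rewrite Rmult_0_l, Rmult_0_l, !Rminus_0_r.
  unfold Rpower; rewrite ln_1, !Rmult_0_r, exp_0; unfold c; ring.
Qed.

(** * The principal power and its derivative along real segments *)

Lemma Cexp_plus u v : Cexp (u + v) = (Cexp u * Cexp v)%C.
Proof.
  unfold Cexp, Cmult; cbn [Re Im fst snd Cplus].
  change (Re (u + v)) with (Re u + Re v); change (Im (u + v)) with (Im u + Im v).
  rewrite exp_plus, cos_plus, sin_plus; apply injective_projections;
    unfold Re, Im; simpl; ring.
Qed.

Lemma Cmod_Cexp u : Cmod (Cexp u) = exp (Re u).
Proof.
  unfold Cmod, Cexp; simpl.
  replace (_ + _) with (exp (Re u) * exp (Re u) *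
    ((sin (Im u))² + (cos (Im u))²)) by (unfold Rsqr; ring).
  rewrite sin2_cos2, Rmult_1_r; apply sqrt_square; left; apply exp_pos.
Qed.

Lemma Cexp_0 : Cexp 0 = RtoC 1.
Proof.
  unfold Cexp; simpl; rewrite exp_0, cos_0, sin_0.
  apply injective_projections; simpl; ring.
Qed.

Lemma Arg_right_half_plane w : 0 < Re w -> Arg w = atan (Im w / Re w).
Proof. intros H; unfold Arg; destruct (Rlt_dec 0 (Re w)); lra. Qed.

Lemma Cmod_pos_of_Re_pos w : 0 < Re w -> 0 < Cmod w.
Proof.
  intros H; pose proof (re_le_Cmod w); rewrite Rabs_pos_eq in H0; lra.
Qed.

(** In polar form, [cos (atan (y/x)) = x/|w|] and [sin (atan (y/x)) = y/|w|]
    when [x > 0]. *)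
Lemma Cexp_Clog w : 0 < Re w -> Cexp (Clog w) = w.
Proof.
  intros H; unfold Cexp, Clog; simpl.
  rewrite exp_ln by (apply Cmod_pos_of_Re_pos, H).
  rewrite Arg_right_half_plane, cos_atan, sin_atan by exact H.
  destruct w as [x y]; simpl in *.
  assert (Hs : Cmod (x, y) = x * sqrt (1 + (y / x)²)).
  { unfold Cmod; simpl.
    replace (x * (x * 1) + y * (y * 1)) with (x * x * (1 + (y / x)²))
      by (unfold Rsqr; field; lra).
    rewrite sqrt_mult_alt, sqrt_square by nra; reflexivity. }
  assert (Hp : 0 < sqrt (1 + (y / x)²)).
  { apply sqrt_lt_R0; pose proof (Rle_0_sqr (y / x)); lra. }
  rewrite Hs; apply injective_projections; simpl; field; lra.
Qed.

Lemma Cmod_Cpower w p : Cmod (Cpower w p) = Rpower (Cmod w) p.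
Proof.
  unfold Cpower; rewrite Cmod_Cexp; unfold Rpower; f_equal; simpl; ring.
Qed.

Lemma Cpower_plus w p q : Cpower w (p + q) = (Cpower w p * Cpower w q)%C.
Proof.
  unfold Cpower; rewrite <- Cexp_plus; f_equal; rewrite RtoC_plus; ring.
Qed.

Lemma Cpower_1 w : 0 < Re w -> Cpower w 1 = w.
Proof.
  intros H; unfold Cpower; rewrite Cmult_1_l; apply Cexp_Clog, H.
Qed.

Lemma Cpower_neq_0 w p : Cpower w p <> 0.
Proof.
  intros H; apply (f_equal Cmod) in H.
  rewrite Cmod_Cpower, Cmod_0 in H.
  pose proof (exp_pos (p * ln (Cmod w))); unfold Rpower in H; lra.
Qed.

Lemma Cpower_opp w p : Cpower w (- p) = (/ Cpower w p)%C.
Proof.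
  assert (H : (Cpower w (- p) * Cpower w p)%C = RtoC 1).
  { rewrite <- Cpower_plus, Rplus_opp_l; unfold Cpower.
    rewrite Cmult_0_l; apply Cexp_0. }
  rewrite <- (Cmult_1_l (/ _)), <- H; field; apply Cpower_neq_0.
Qed.

Lemma Cpower_RtoC x p : 0 < x -> Cpower (RtoC x) p = RtoC (Rpower x p).
Proof.
  intros Hx; unfold Cpower, Clog.
  rewrite Arg_right_half_plane, Cmod_R, Rabs_pos_eq by (simpl; lra).
  simpl; unfold Rdiv; rewrite Rmult_0_l, atan_0.
  unfold Cexp, Rpower; simpl.
  replace (p * 0 + 0 * ln x) with 0 by ring.
  rewrite cos_0, sin_0.
  apply injective_projections; simpl; [|ring].
  rewrite Rmult_1_r; f_equal; ring.
Qed.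

(** Componentwise form of the derivative of a curve in the plane, so that
    real one-variable calculus applies directly. *)
Definition is_derive_RC (F : R -> C) (s : R) (l : C) : Prop :=
  is_derive (fun t => Re (F t)) s (Re l) /\
  is_derive (fun t => Im (F t)) s (Im l).

Lemma continuous_RC (F : R -> C) s :
  continuous (fun t => Re (F t)) s -> continuous (fun t => Im (F t)) s ->
  continuous (U := C_UniformSpace) F s.
Proof.
  intros H1 H2 P [eps HP].
  specialize (H1 _ (locally_ball (Re (F s)) eps)).
  specialize (H2 _ (locally_ball (Im (F s)) eps)).
  unfold filtermap in H1, H2 |- *.
  generalize (filter_and _ _ H1 H2); apply filter_imp.
  intros t [Ha Hb]; apply HP; split; assumption.
Qed.

Lemma continuous_Re_RC (F : R -> C) s :
  continuous (U := C_UniformSpace) F s -> continuous (fun t => Re (F t)) s.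
Proof.
  intros H; apply (continuous_comp F Re); [exact H|].
  unfold Re; destruct (F s) as [x y]; apply continuous_fst.
Qed.

Lemma continuous_Im_RC (F : R -> C) s :
  continuous (U := C_UniformSpace) F s -> continuous (fun t => Im (F t)) s.
Proof.
  intros H; apply (continuous_comp F Im); [exact H|].
  unfold Im; destruct (F s) as [x y]; apply continuous_snd.
Qed.

Lemma continuous_Cmult_RC (F G : R -> C) s :
  continuous (U := C_UniformSpace) F s -> continuous (U := C_UniformSpace) G s ->
  continuous (U := C_UniformSpace) (fun t => F t * G t)%C s.
Proof.
  intros HF HG.
  pose proof (continuous_Re_RC F s HF); pose proof (continuous_Im_RC F s HF).
  pose proof (continuous_Re_RC G s HG); pose proof (continuous_Im_RC G s HG).
  apply continuous_RC; simpl.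
  - apply (continuous_minus (fun t => Re (F t) * Re (G t))
             (fun t => Im (F t) * Im (G t))).
    + now apply (continuous_mult (fun t => Re (F t)) (fun t => Re (G t))).
    + now apply (continuous_mult (fun t => Im (F t)) (fun t => Im (G t))).
  - apply (continuous_plus (fun t => Re (F t) * Im (G t))
             (fun t => Im (F t) * Re (G t))).
    + now apply (continuous_mult (fun t => Re (F t)) (fun t => Im (G t))).
    + now apply (continuous_mult (fun t => Im (F t)) (fun t => Re (G t))).
Qed.

Lemma is_derive_RC_continuous F s l :
  is_derive_RC F s l -> continuous (U := C_UniformSpace) F s.
Proof.
  intros [H1 H2]; apply continuous_RC.
  - apply (ex_derive_continuous (fun t => Re (F t))); eexists; exact H1.
  - apply (ex_derive_continuous (fun t => Im (F t))); eexists; exact H2.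
Qed.

(** The real mean value theorem fails for complex values; applied to the
    component of [F] in the direction [u = F 1 - F 0], whose increment is
    [|u|^2], it still yields the inequality. *)
Lemma Cmod_increment_le (F F' : R -> C) B :
  (forall s, 0 <= s <= 1 -> is_derive_RC F s (F' s)) ->
  (forall s, 0 <= s <= 1 -> Cmod (F' s) <= B) ->
  Cmod (F 1 - F 0) <= B.
Proof.
  intros HF HB; set (u := (F 1 - F 0)%C).
  pose (p := fun s => Re u * Re (F s) + Im u * Im (F s)).
  pose (dp := fun s => Re u * Re (F' s) + Im u * Im (F' s)).
  assert (Hp : forall s, 0 <= s <= 1 -> is_derive p s (dp s)).
  { intros s Hs; destruct (HF s Hs) as [H1 H2].
    apply (is_derive_plus (fun s => Re u * Re (F s)) (fun s => Im u * Im (F s))).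
    - exact (is_derive_scal _ s (Re u) _ H1).
    - exact (is_derive_scal _ s (Im u) _ H2). }
  destruct (MVT_gen p 0 1 dp) as [c [Hc Heq]].
  - intros s; rewrite Rmin_left, Rmax_right by lra; intros Hs; apply Hp; lra.
  - intros s; rewrite Rmin_left, Rmax_right by lra; intros Hs.
    apply continuity_pt_filterlim, (ex_derive_continuous p).
    eexists; apply Hp, Hs.
  - rewrite Rmin_left, Rmax_right in Hc by lra.
    assert (Hu : Cmod u ^ 2 = dp c).
    { rewrite Cmod2_alt.
      replace (dp c) with (p 1 - p 0) by (rewrite Heq; ring).
      unfold p, u, Re, Im; simpl; ring. }
    assert (Hd : dp c <= Cmod u * Cmod (F' c)).
    { rewrite <- (Cmod_conj u), <- Cmod_mult.
      pose proof (re_le_Cmod (Cconj u * F' c)) as H.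
      pose proof (Rle_abs (Re (Cconj u * F' c))).
      unfold dp, Re, Im in *; simpl in *; lra. }
    pose proof (HB c Hc); pose proof (Cmod_ge_0 u); pose proof (Cmod_ge_0 (F' c)).
    destruct (Rle_lt_dec (Cmod u) B) as [|Hlt]; [assumption|nra].
Qed.

(** Near [s] the argument is [atan (y/x)], so
    [w^p = exp (p/2 ln (x^2+y^2)) (cos (p atan (y/x)) + i sin (p atan (y/x)))]
    and each component is differentiated as a real function. *)
Lemma is_derive_RC_Cpower_line p (w k : C) (s : R) :
  0 < Re (w + s * k) ->
  is_derive_RC (fun s : R => Cpower (w + s * k) p) s
    (p * k * Cpower (w + s * k) (p - 1))%C.
Proof.
  intros Hpos; destruct w as [x y], k as [h1 h2].
  set (w := fun s : R => ((x, y) + s * (h1, h2))%C).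
  assert (Hw : forall s, w s = (x + s * h1, y + s * h2)).
  { intros t; unfold w; apply injective_projections; simpl; ring. }
  assert (Hc : Cpower (w s) (p - 1) = (Cpower (w s) p / w s)%C).
  { unfold Rminus; rewrite Cpower_plus, Cpower_opp.
    rewrite Cpower_1 by exact Hpos; reflexivity. }
  change (is_derive_RC (fun s => Cpower (w s) p) s
    (p * (h1, h2) * Cpower (w s) (p - 1))%C).
  change (0 < Re (w s)) in Hpos; rewrite Hc; clear Hc.
  pose (L := fun s => p * (/ 2 * ln ((x + s * h1) ^ 2 + (y + s * h2) ^ 2))).
  pose (A := fun s => p * atan ((y + s * h2) / (x + s * h1))).
  assert (Hloc : locally s (fun t => 0 < x + t * h1)).
  { assert (Hcont : continuous (fun t => x + t * h1) s).
    { apply (ex_derive_continuous (fun t => x + t * h1)); auto_derive; exact I. }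
    apply (Hcont (fun v => 0 < v)); apply locally_pos.
    rewrite Hw in Hpos; exact Hpos. }
  assert (HE : locally s (fun t =>
    (exp (L t) * cos (A t), exp (L t) * sin (A t)) = Cpower (w t) p)).
  { apply filter_imp with (2 := Hloc); intros t Ht.
    unfold Cpower, Clog; rewrite Arg_right_half_plane by (rewrite Hw; exact Ht).
    rewrite Hw; unfold Cexp, Cmod; simpl Re; simpl Im.
    rewrite Rmult_0_l, Rminus_0_r, Rmult_0_l, Rplus_0_r.
    assert (Hl : ln (sqrt ((x + t * h1) ^ 2 + (y + t * h2) ^ 2)) =
      / 2 * ln ((x + t * h1) ^ 2 + (y + t * h2) ^ 2)).
    { pose proof (pow_lt _ 2 Ht); pose proof (pow2_ge_0 (y + t * h2)).
      rewrite <- Rpower_sqrt by lra; unfold Rpower; apply ln_exp. }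
    cbn [fst snd]; simpl pow in Hl; rewrite Hl; reflexivity. }
  rewrite Hw in Hpos; simpl in Hpos.
  assert (Hn : 0 < (x + s * h1) ^ 2 + (y + s * h2) ^ 2).
  { pose proof (pow_lt _ 2 Hpos); pose proof (pow2_ge_0 (y + s * h2)); lra. }
  assert (Hs : (exp (L s) * cos (A s), exp (L s) * sin (A s)) = Cpower (w s) p).
  { exact (locally_singleton _ _ HE). }
  rewrite <- Hs, Hw.
  split.
  - apply is_derive_ext_loc with (fun t => exp (L t) * cos (A t)).
    { apply filter_imp with (2 := HE); intros t Ht; rewrite <- Ht; reflexivity. }
    unfold L, A; auto_derive.
    + repeat split; try lra; nra.
    + unfold Cdiv, Cinv, Cmult; simpl; unfold Rdiv.
      simpl in Hn; field; nra.
  - apply is_derive_ext_loc with (fun t => exp (L t) * sin (A t)).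
    { apply filter_imp with (2 := HE); intros t Ht; rewrite <- Ht; reflexivity. }
    unfold L, A; auto_derive.
    + repeat split; try lra; nra.
    + unfold Cdiv, Cinv, Cmult; simpl; unfold Rdiv.
      simpl in Hn; field; nra.
Qed.

(** * Differentiating a power kernel under the integral sign *)

Lemma Rpower_le_base_neg d x q :
  0 < d <= x -> q <= 0 -> Rpower x q <= Rpower d q.
Proof.
  intros [Hd Hx] Hq.
  replace q with (- (- q)) by ring; rewrite !(Rpower_Ropp _ (- q)).
  apply Rinv_le_contravar; [apply exp_pos|].
  apply Rle_Rpower_l; lra.
Qed.

Lemma Cmod_Cpower_le d (w : C) q :
  0 < d -> d <= Re w -> q <= 0 -> Cmod (Cpower w q) <= Rpower d q.
Proof.
  intros Hd Hw Hq; rewrite Cmod_Cpower; apply Rpower_le_base_neg; [|exact Hq].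
  pose proof (re_le_Cmod w); pose proof (Rle_abs (Re w)); lra.
Qed.

(** For [q <= 1] the derivative [q w^(q-1)] is largest at the smallest modulus,
    which is at least [d]. *)
Lemma Cpower_lipschitz d q (w k : C) :
  0 < d -> q <= 1 ->
  (forall s : R, 0 <= s <= 1 -> d <= Re (w + s * k)) ->
  Cmod (Cpower (w + k) q - Cpower w q) <= Rabs q * Rpower d (q - 1) * Cmod k.
Proof.
  intros Hd Hq Hre.
  replace (w + k)%C with (w + RtoC 1 * k)%C by ring.
  replace (Cpower w q) with (Cpower (w + RtoC 0 * k) q) by (f_equal; ring).
  apply (Cmod_increment_le (fun s : R => Cpower (w + s * k) q)
           (fun s : R => q * k * Cpower (w + s * k) (q - 1))%C).
  - intros s Hs; apply is_derive_RC_Cpower_line.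
    specialize (Hre s Hs); lra.
  - intros s Hs; rewrite !Cmod_mult, Cmod_R.
    pose proof (Cmod_Cpower_le d (w + s * k) (q - 1) Hd (Hre s Hs) ltac:(lra)).
    pose proof (Rabs_pos q); pose proof (Cmod_ge_0 k).
    rewrite (Rmult_assoc (Rabs q) (Rpower d (q - 1))), (Rmult_comm (Rpower d _)).
    rewrite <- Rmult_assoc; apply Rmult_le_compat_l; [nra|assumption].
Qed.

(** The remainder is the increment of [s |-> (w+sk)^p - s p k w^(p-1)], whose
    derivative is [p k] times an increment of the power [p-1]; the Lipschitz
    bound supplies the second factor [|k|]. *)
Lemma Cpower_taylor d p (w k : C) :
  0 < d -> p <= 2 ->
  (forall s : R, 0 <= s <= 1 -> d <= Re (w + s * k)) ->
  Cmod (Cpower (w + k) p - Cpower w p - p * k * Cpower w (p - 1)) <=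
    Rabs p * Rabs (p - 1) * Rpower d (p - 2) * Cmod k ^ 2.
Proof.
  intros Hd Hp Hre.
  set (l := (p * k * Cpower w (p - 1))%C).
  assert (Hlin : forall c s : R, is_derive (fun t => t * c) s c).
  { intros c s; auto_derive; [exact I | ring]. }
  replace (Cpower (w + k) p - Cpower w p - l)%C with
    ((Cpower (w + RtoC 1 * k) p - RtoC 1 * l)
     - (Cpower (w + RtoC 0 * k) p - RtoC 0 * l))%C.
  2:{ replace (w + RtoC 1 * k)%C with (w + k)%C by ring.
      replace (w + RtoC 0 * k)%C with w by ring; ring. }
  apply (Cmod_increment_le (fun s : R => (Cpower (w + s * k) p - s * l))%C
    (fun s : R => p * k * Cpower (w + s * k) (p - 1) - l)%C).
  - intros s Hs.
    destruct (is_derive_RC_Cpower_line p w k s) as [H1 H2].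
    { specialize (Hre s Hs); lra. }
    split.
    + apply (is_derive_ext
        (fun t : R => minus (Re (Cpower (w + t * k) p)) (t * Re l))).
      { intros t; generalize (Cpower (w + t * k) p), l; intros [] [].
        unfold minus, plus, opp; simpl; ring. }
      apply (is_derive_minus _ (fun t : R => t * Re l) s _ (Re l) H1).
      apply Hlin.
    + apply (is_derive_ext
        (fun t : R => minus (Im (Cpower (w + t * k) p)) (t * Im l))).
      { intros t; generalize (Cpower (w + t * k) p), l; intros [] [].
        unfold minus, plus, opp; simpl; ring. }
      apply (is_derive_minus _ (fun t : R => t * Im l) s _ (Im l) H2).
      apply Hlin.
  - intros s Hs.
    replace (p * k * Cpower (w + s * k) (p - 1) - l)%C with
      (p * k * (Cpower (w + s * k) (p - 1) - Cpower w (p - 1)))%C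
      by (unfold l; ring).
    rewrite !Cmod_mult, Cmod_R.
    assert (HL : Cmod (Cpower (w + s * k) (p - 1) - Cpower w (p - 1)) <=
                 Rabs (p - 1) * Rpower d (p - 1 - 1) * Cmod (s * k)).
    { apply Cpower_lipschitz; [exact Hd | lra |].
      intros s' Hs'; replace (s' * (s * k))%C with (RtoC (s' * s) * k)%C
        by (rewrite RtoC_mult; ring).
      apply Hre; split; nra. }
    replace (p - 1 - 1) with (p - 2) in HL by ring.
    rewrite Cmod_mult, Cmod_R, (Rabs_pos_eq s) in HL by lra.
    pose proof (Rabs_pos p); pose proof (Cmod_ge_0 k); pose proof (Rabs_pos (p - 1)).
    assert (0 < Rpower d (p - 2)) by apply exp_pos.
    set (A := Rabs (p - 1) * Rpower d (p - 2)) in *.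
    assert (0 <= A) by (apply Rmult_le_pos; lra).
    replace (Rabs p * Rabs (p - 1) * Rpower d (p - 2) * Cmod k ^ 2) with
      (Rabs p * Cmod k * (A * Cmod k)) by (unfold A; ring).
    apply Rmult_le_compat_l; [nra|].
    apply Rle_trans with (1 := HL).
    apply Rmult_le_compat_l; [assumption|nra].
Qed.

(** A quadratic remainder is more than differentiability asks for, but it is
    what survives integration in a parameter. *)
Lemma is_derive_C_of_quadratic (F : C -> C) (z l : C) d B :
  0 < d ->
  (forall h : C, Cmod h < d ->
     Cmod (F (z + h) - F z - h * l)%C <= B * Cmod h ^ 2) ->
  is_derive (K := C_AbsRing) (V := C_NormedModule) F z l.
Proof.
  intros Hd HB; split; [apply is_linear_scal_l|].
  intros x Hx.
  apply (is_filter_lim_locally_unique (V := AbsRing_NormedModule C_AbsRing) z x) in Hx.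
  subst x.
  intros eps.
  assert (Hr : 0 < Rmin d (eps / (Rabs B + 1))).
  { apply Rmin_pos; [exact Hd|].
    apply Rdiv_lt_0_compat; [apply cond_pos | pose proof (Rabs_pos B); lra]. }
  exists (mkposreal _ Hr); intros y Hy.
  change (Cmod (y - z)%C < Rmin d (eps / (Rabs B + 1))) in Hy.
  change (Cmod ((F y - F z) - (y - z) * l)%C <= eps * Cmod (y - z)%C).
  set (h := (y - z)%C) in *.
  (* The type of [y] hides the ring structure of the plane from [ring]. *)
  assert (Hsub : forall u v : C, u = (v + (u - v))%C) by (intros; ring).
  pose proof (Hsub y z) as Hyz; fold h in Hyz.
  rewrite Hyz; clearbody h; clear Hyz y.
  pose proof (Rmin_l d (eps / (Rabs B + 1))); pose proof (Rmin_r d (eps / (Rabs B + 1))).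
  apply Rle_trans with (1 := HB h ltac:(lra)).
  assert (Hh : Cmod h * (Rabs B + 1) <= eps).
  { pose proof (Rabs_pos B).
    apply Rmult_le_reg_r with (/ (Rabs B + 1)); [apply Rinv_0_lt_compat; lra|].
    rewrite Rmult_assoc, Rinv_r, Rmult_1_r by lra; unfold Rdiv in *; lra. }
  pose proof (Cmod_ge_0 h); pose proof (Rle_abs B); nra.
Qed.

(** The integral is taken over the real structure of the plane, with respect to
    which multiplication by a complex constant is not a scalar action; hence
    [is_Cint_Cmult] below. *)
Definition is_Cint (g : R -> C) (l : C) : Prop :=
  is_RInt (V := C_R_NormedModule) g 0 1 l.

Definition Cint (g : R -> C) : C :=
  RInt (V := C_R_CompleteNormedModule) g 0 1.

Lemma Cint_correct (g : R -> C) :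
  (forall t, 0 <= t <= 1 -> continuous (U := C_UniformSpace) g t) ->
  is_Cint g (Cint g).
Proof.
  intros H; apply (RInt_correct (V := C_R_CompleteNormedModule)).
  apply (ex_RInt_continuous (V := C_R_CompleteNormedModule)).
  intros t; rewrite Rmin_left, Rmax_right by lra; apply H.
Qed.

Lemma is_Cint_minus g1 g2 l1 l2 :
  is_Cint g1 l1 -> is_Cint g2 l2 ->
  is_Cint (fun t => g1 t - g2 t)%C (l1 - l2)%C.
Proof. intros H1 H2; exact (is_RInt_minus g1 g2 0 1 l1 l2 H1 H2). Qed.

Lemma is_Cint_Cmult (c : C) g l :
  is_Cint g l -> is_Cint (fun t => c * g t)%C (c * l)%C.
Proof.
  intros H.
  pose proof (is_RInt_fct_extend_fst _ _ _ _ H) as H1.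
  pose proof (is_RInt_fct_extend_snd _ _ _ _ H) as H2.
  apply (is_RInt_fct_extend_pair (U := R_NormedModule) (V := R_NormedModule)
           (fun t => c * g t)%C).
  - exact (is_RInt_minus _ _ 0 1 _ _
             (is_RInt_scal _ 0 1 (fst c) _ H1) (is_RInt_scal _ 0 1 (snd c) _ H2)).
  - exact (is_RInt_plus _ _ 0 1 _ _
             (is_RInt_scal _ 0 1 (fst c) _ H2) (is_RInt_scal _ 0 1 (snd c) _ H1)).
Qed.

Lemma is_Cint_Re g l : is_Cint g l -> is_RInt (fun t => Re (g t)) 0 1 (Re l).
Proof. intros H; exact (is_RInt_fct_extend_fst _ _ _ _ H). Qed.

Lemma Cmod_is_Cint_le g (m : R -> R) l I :
  (forall t, 0 <= t <= 1 -> Cmod (g t) <= m t) ->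
  is_Cint g l -> is_RInt m 0 1 I -> Cmod l <= I.
Proof.
  intros Hm Hg HI; rewrite Cmod_norm.
  apply (norm_RInt_le (V := C_R_NormedModule) g m 0 1 l I); try assumption; [lra|].
  intros t Ht; rewrite <- Cmod_norm; auto.
Qed.

Lemma Cmod_is_Cint_le_const g B l :
  (forall t, 0 <= t <= 1 -> Cmod (g t) <= B) -> is_Cint g l -> Cmod l <= B.
Proof.
  intros HB Hg; apply Cmod_is_Cint_le with (1 := HB) (2 := Hg).
  pose proof (is_RInt_const (V := R_NormedModule) 0 1 B) as H.
  unfold scal in H; simpl in H; unfold mult in H; simpl in H.
  rewrite Rminus_0_r, Rmult_1_l in H; exact H.
Qed.

Lemma Re_one_sub_mul_ge (z : C) (t : R) :
  0 <= t <= 1 -> 1 - Cmod z <= Re (1 - t * z).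
Proof.
  intros Ht; pose proof (re_le_Cmod z); pose proof (Rle_abs (Re z)).
  pose proof (Cmod_ge_0 z); unfold Re in *; simpl.
  destruct (Rle_dec 0 (fst z)); nra.
Qed.

Lemma continuous_Cpower_kernel (z : C) p (t : R) :
  disk z -> 0 <= t <= 1 ->
  continuous (U := C_UniformSpace) (fun t : R => Cpower (1 - t * z) p) t.
Proof.
  unfold disk; intros Hz Ht.
  pose proof (Re_one_sub_mul_ge z t Ht) as Hre.
  assert (H : is_derive_RC (fun s : R => Cpower (1 + s * - z) p) t
                (p * - z * Cpower (1 + t * - z) (p - 1))%C).
  { apply is_derive_RC_Cpower_line.
    replace (1 + t * - z)%C with (1 - t * z)%C by ring; lra. }
  apply is_derive_RC_continuous in H.
  apply (continuous_ext (T := R_UniformSpace) (U := C_UniformSpace)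
    (fun s : R => Cpower (1 + s * - z) p)); [|exact H].
  intros s; f_equal; ring.
Qed.

(** With [d = (1-|z|)/2], all points [1 - t(z+sh)] with [|h| < d] stay in
    [Re w >= d], so the Taylor remainder is bounded by a multiple of [|h|^2]
    uniformly in [t] and can be integrated. *)
Lemma is_derive_Cint_kernel (G : R -> C) M p (z : C) :
  (forall t, 0 <= t <= 1 -> continuous (U := C_UniformSpace) G t) ->
  (forall t, 0 <= t <= 1 -> Cmod (G t) <= M) ->
  p <= 2 -> disk z ->
  is_derive (K := C_AbsRing) (V := C_NormedModule)
    (fun z => Cint (fun t => G t * Cpower (1 - t * z) p)%C) z
    (Cint (fun t => RtoC (- p * t) * G t * Cpower (1 - t * z) (p - 1))%C).
Proof.
  intros HGc HGM Hp Hz.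
  set (d := (1 - Cmod z) / 2).
  assert (Hd : 0 < d) by (unfold d, disk in *; lra).
  apply is_derive_C_of_quadratic with d
    (M * (Rabs p * Rabs (p - 1) * Rpower d (p - 2))); [exact Hd|].
  intros h Hh.
  assert (Hzh : disk (z + h)).
  { unfold disk; pose proof (Cmod_triangle z h); unfold d in *; lra. }
  assert (Hc : forall t : R, 0 <= t <= 1 ->
    continuous (U := C_UniformSpace) (fun t : R => RtoC (- p * t) * G t)%C t).
  { intros t Ht; apply continuous_Cmult_RC; [|auto].
    apply continuous_RC; unfold Re, Im; simpl; [|apply continuous_const].
    apply (ex_derive_continuous (fun t => - p * t)); auto_derive; exact I. }
  assert (I1 := Cint_correct (fun t => G t * Cpower (1 - t * (z + h)) p)%C
    (fun t Ht => continuous_Cmult_RC _ _ t (HGc t Ht)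
                   (continuous_Cpower_kernel _ p t Hzh Ht))).
  assert (I2 := Cint_correct (fun t => G t * Cpower (1 - t * z) p)%C
    (fun t Ht => continuous_Cmult_RC _ _ t (HGc t Ht)
                   (continuous_Cpower_kernel _ p t Hz Ht))).
  assert (I3 := Cint_correct
    (fun t => RtoC (- p * t) * G t * Cpower (1 - t * z) (p - 1))%C
    (fun t Ht => continuous_Cmult_RC _ _ t (Hc t Ht)
                   (continuous_Cpower_kernel _ (p - 1) t Hz Ht))).
  apply Cmod_is_Cint_le_const with
    (2 := is_Cint_minus _ _ _ _ (is_Cint_minus _ _ _ _ I1 I2)
            (is_Cint_Cmult h _ _ I3)).
  intros t Ht; simpl.
  replace (G t * Cpower (1 - t * (z + h)) p - G t * Cpower (1 - t * z) p -
     h * (RtoC (- p * t) * G t * Cpower (1 - t * z) (p - 1)))%C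
  with (G t * (Cpower ((1 - t * z) + (- t * h)) p - Cpower (1 - t * z) p
        - p * (- t * h) * Cpower (1 - t * z) (p - 1)))%C.
  2:{ replace ((1 - t * z) + (- t * h))%C with (1 - t * (z + h))%C by ring.
      rewrite RtoC_mult, RtoC_opp; ring. }
  assert (HT := Cpower_taylor d p (1 - t * z) (- t * h) Hd Hp).
  rewrite Cmod_mult, Rmult_assoc.
  pose proof (Cmod_ge_0 (G t)); pose proof (HGM t Ht).
  apply Rmult_le_compat; [apply Cmod_ge_0 | apply Cmod_ge_0 | assumption |].
  apply Rle_trans with (1 := HT ltac:(
    intros s Hs;
    replace (1 - t * z + s * (- t * h))%C with (1 - t * (z + s * h))%C by ring;
    apply Rle_trans with (2 := Re_one_sub_mul_ge (z + s * h) t Ht);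
    pose proof (Cmod_triangle z (s * h)) as Htri;
    rewrite Cmod_mult, Cmod_R, Rabs_pos_eq in Htri by lra;
    pose proof (Cmod_ge_0 h); unfold d in *; nra)).
  apply Rmult_le_compat_l.
  - apply Rmult_le_pos; [|left; apply exp_pos].
    apply Rmult_le_pos; apply Rabs_pos.
  - rewrite Cmod_mult, Cmod_opp, Cmod_R, Rabs_pos_eq by lra.
    pose proof (Cmod_ge_0 h); apply (pow_incr (t * Cmod h) (Cmod h) 2); nra.
Qed.

(** The missing piece over [x,1] has modulus at most [B (1-x)].  The two
    integrands are compared only on the open interval, which leaves the value at
    1 free. *)
Lemma RInt_gen_at_left_eq_Cint (g g0 : R -> C) B :
  (forall t, 0 <= t <= 1 -> continuous (U := C_UniformSpace) g t) ->
  (forall t, 0 <= t <= 1 -> Cmod (g t) <= B) ->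
  (forall t, 0 < t < 1 -> g t = g0 t) ->
  RInt_gen (V := C_R_CompleteNormedModule) g0 (at_point 0) (at_left 1) = Cint g.
Proof.
  intros Hc HB He.
  assert (Hr : at_left 1 (fun x => 0 < x < 1)).
  { exists (mkposreal 1 Rlt_0_1); intros x Hx Hx1.
    change (Rabs (x - 1) < 1) in Hx; apply Rabs_def2 in Hx; lra. }
  apply (is_RInt_gen_unique (V := C_R_CompleteNormedModule)).
  apply (is_RInt_gen_ext (V := C_R_NormedModule) g).
  { apply Filter_prod with (1 := eq_refl : at_point 0 (fun a => a = 0)) (2 := Hr).
    intros a x -> Hx t; simpl.
    rewrite Rmin_left, Rmax_right by lra; intros Ht; apply He; lra. }
  intros P [eps HP].
  assert (HB0 : 0 <= B).
  { apply Rle_trans with (2 := HB 0 ltac:(lra)); apply Cmod_ge_0. }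
  assert (Hd : 0 < eps / (B + 1)).
  { apply Rdiv_lt_0_compat; [apply cond_pos|lra]. }
  assert (Hx : at_left 1 (fun x => 0 < x < 1 /\ 1 - x < eps / (B + 1))).
  { apply filter_and; [exact Hr|].
    exists (mkposreal _ Hd); intros x Hx Hx1.
    change (Rabs (x - 1) < eps / (B + 1)) in Hx; apply Rabs_def2 in Hx; lra. }
  apply Filter_prod with (1 := eq_refl : at_point 0 (fun a => a = 0)) (2 := Hx).
  intros a x -> [Hx01 Hxe]; simpl.
  assert (E1 : ex_RInt (V := C_R_CompleteNormedModule) g 0 x).
  { apply (ex_RInt_continuous (V := C_R_CompleteNormedModule)).
    intros t; rewrite Rmin_left, Rmax_right by lra; intros; apply Hc; lra. }
  assert (E2 : ex_RInt (V := C_R_CompleteNormedModule) g x 1).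
  { apply (ex_RInt_continuous (V := C_R_CompleteNormedModule)).
    intros t; rewrite Rmin_left, Rmax_right by lra; intros; apply Hc; lra. }
  set (u := RInt (V := C_R_CompleteNormedModule) g 0 x).
  set (v := RInt (V := C_R_CompleteNormedModule) g x 1).
  assert (Hu : is_RInt (V := C_R_NormedModule) g 0 x u)
    by exact (RInt_correct (V := C_R_CompleteNormedModule) _ _ _ E1).
  assert (Hv : is_RInt (V := C_R_NormedModule) g x 1 v)
    by exact (RInt_correct (V := C_R_CompleteNormedModule) _ _ _ E2).
  exists u; split; [exact Hu|].
  apply HP, (C_NormedModule_mixin_compat1 (Cint g) u).
  assert (Hs : Cint g = (u + v)%C).
  { symmetry; exact (RInt_Chasles (V := C_R_CompleteNormedModule) g 0 x 1 E1 E2). }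
  change (Cmod (u - Cint g)%C < eps); rewrite Hs.
  replace (u - (u + v))%C with (- v)%C by ring; rewrite Cmod_opp.
  assert (Hle : Cmod v <= (1 - x) * B).
  { rewrite Cmod_norm.
    apply (norm_RInt_le (V := C_R_NormedModule) g (fun _ => B) x 1 v);
      [lra | | exact Hv | apply @is_RInt_const].
    intros t Ht; rewrite <- Cmod_norm; apply HB; lra. }
  apply Rle_lt_trans with (1 := Hle).
  apply Rle_lt_trans with ((1 - x) * (B + 1)); [nra|].
  apply Rmult_lt_reg_r with (/ (B + 1)); [apply Rinv_0_lt_compat; lra|].
  rewrite Rmult_assoc, Rinv_r, Rmult_1_r by lra; exact Hxe.
Qed.

(** * The Hilbert operator: derivative and norm bounds *)

Lemma locally_disk (z : C) :
  disk z -> locally (T := AbsRing_UniformSpace C_AbsRing) z disk.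
Proof.
  unfold disk; intros Hz.
  assert (Hr : 0 < 1 - Cmod z) by lra.
  exists (mkposreal _ Hr); intros y Hy.
  change (Cmod (y - z)%C < 1 - Cmod z) in Hy.
  assert (Hsub : forall u v : C, u = (v + (u - v))%C) by (intros; ring).
  rewrite (Hsub y z); pose proof (Cmod_triangle z (y - z)); lra.
Qed.

Lemma disk_RtoC t : -1 < t < 1 -> disk (RtoC t).
Proof. intros Ht; unfold disk; rewrite Cmod_R; apply Rabs_def1; lra. Qed.

Lemma continuous_analytic_RtoC f t :
  analytic_on_disk f -> -1 < t < 1 ->
  continuous (U := C_UniformSpace) (fun t => f (RtoC t)) t.
Proof.
  intros Hf Ht.
  pose proof (ex_derive_continuous (K := C_AbsRing) (V := C_NormedModule)
                f (RtoC t) (Hf _ (disk_RtoC t Ht))) as Hc.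
  apply (filterlim_comp _ _ _ RtoC f _
           (locally (T := AbsRing_UniformSpace C_AbsRing) (RtoC t))); [|exact Hc].
  intros P [eps HP]; exists eps; intros y Hy; apply HP.
  change (Cmod (RtoC y - RtoC t)%C < eps).
  rewrite <- RtoC_minus, Cmod_R; exact Hy.
Qed.

(** At [t = 1] the weight is 0, so the value of [f] at the boundary point does
    not matter. *)
Definition weighted (b : R) (f : C -> C) (t : R) : C :=
  (f (RtoC t) * RtoC (vanishing_power (1 - t) b))%C.

Definition disk_bounded (f : C -> C) (M : R) : Prop :=
  forall z, disk z -> Cmod (f z) <= M.

Lemma disk_bounded_ge0 f M : disk_bounded f M -> 0 <= M.
Proof.
  intros H; apply Rle_trans with (2 := H (RtoC 0) (disk_RtoC 0 ltac:(lra))).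
  apply Cmod_ge_0.
Qed.

(** Beyond [t = 1] both sides vanish; the bound is needed on both sides of 1 to
    prove continuity there. *)
Lemma Cmod_weighted_le b f M t :
  disk_bounded f M -> -1 < t ->
  Cmod (weighted b f t) <= M * vanishing_power (1 - t) b.
Proof.
  intros Hf Ht; unfold weighted; rewrite Cmod_mult, Cmod_R.
  rewrite Rabs_pos_eq by apply vanishing_power_ge0.
  destruct (Rlt_dec t 1) as [Hlt|Hge].
  - apply Rmult_le_compat_r; [apply vanishing_power_ge0|].
    apply Hf, disk_RtoC; lra.
  - rewrite vanishing_power_npos by lra; lra.
Qed.

Lemma vanishing_power_le1 x b : 0 <= x <= 1 -> 0 < b -> vanishing_power x b <= 1.
Proof.
  intros Hx Hb; destruct (Rlt_dec 0 x) as [Hp|].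
  - rewrite vanishing_power_pos by exact Hp.
    apply Rle_trans with (Rpower 1 b); [apply Rle_Rpower_l; lra|].
    unfold Rpower; rewrite ln_1, Rmult_0_r, exp_0; lra.
  - rewrite vanishing_power_npos; lra.
Qed.

Lemma Cmod_weighted_le_const b f M t :
  0 < b -> disk_bounded f M -> 0 <= t <= 1 -> Cmod (weighted b f t) <= M.
Proof.
  intros Hb Hf Ht.
  apply Rle_trans with (1 := Cmod_weighted_le b f M t Hf ltac:(lra)).
  pose proof (vanishing_power_le1 (1 - t) b ltac:(lra) Hb).
  pose proof (disk_bounded_ge0 f M Hf); nra.
Qed.

(** At [t = 1] boundedness of [f] suffices, since the weight tends to 0. *)
Lemma continuous_weighted b f M t :
  0 < b -> analytic_on_disk f -> disk_bounded f M -> 0 <= t <= 1 ->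
  continuous (U := C_UniformSpace) (weighted b f) t.
Proof.
  intros Hb Ha Hf Ht; destruct (Req_dec t 1) as [->|Hne].
  - intros P [eps HP].
    pose proof (disk_bounded_ge0 f M Hf) as HM.
    destruct (vanishing_power_small b (eps / (M + 1)) Hb) as [d Hd].
    { apply Rdiv_lt_0_compat; [apply cond_pos|lra]. }
    assert (Hr : 0 < Rmin d 1) by (apply Rmin_pos; [apply cond_pos|lra]).
    exists (mkposreal _ Hr); intros y Hy.
    change (Rabs (y - 1) < Rmin d 1) in Hy.
    pose proof (Rmin_l d 1); pose proof (Rmin_r d 1).
    apply HP, (C_NormedModule_mixin_compat1 (weighted b f 1) (weighted b f y)).
    change (Cmod (weighted b f y - weighted b f 1)%C < eps).
    unfold weighted at 2.
    rewrite (vanishing_power_npos (1 - 1)) by lra.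
    rewrite Cmult_0_r, <- (Cplus_0_r (weighted b f y)) at 1.
    replace (weighted b f y + 0 - 0)%C with (weighted b f y) by ring.
    assert (Hy1 : -1 < y) by (apply Rabs_def2 in Hy; lra).
    apply Rle_lt_trans with (1 := Cmod_weighted_le b f M y Hf Hy1).
    assert (Hv : vanishing_power (1 - y) b < eps / (M + 1)).
    { apply Hd; rewrite Rabs_minus_sym; lra. }
    pose proof (vanishing_power_ge0 (1 - y) b).
    apply Rle_lt_trans with ((M + 1) * vanishing_power (1 - y) b); [nra|].
    replace (pos eps) with ((M + 1) * (eps / (M + 1))) by (field; lra).
    apply Rmult_lt_compat_l; lra.
  - apply continuous_Cmult_RC.
    + apply continuous_analytic_RtoC; [exact Ha|lra].
    + apply continuous_RC; unfold Re, Im; simpl; [|apply continuous_const].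
      apply (continuous_comp (fun t => 1 - t) (fun y => vanishing_power y b)).
      * apply (ex_derive_continuous (fun t => 1 - t)); auto_derive; exact I.
      * apply continuous_vanishing_power, Hb.
Qed.

Lemma Hilbert_op_eq_Cint b f M z :
  0 < b -> analytic_on_disk f -> disk_bounded f M -> disk z ->
  Hilbert_op b f z =
    Cint (fun t => weighted b f t * Cpower (1 - t * z) (- (b + 1)))%C.
Proof.
  intros Hb Ha Hf Hz.
  apply RInt_gen_at_left_eq_Cint with (M * Rpower (1 - Cmod z) (- (b + 1))).
  - intros t Ht; apply continuous_Cmult_RC.
    + apply continuous_weighted with M; assumption.
    + apply continuous_Cpower_kernel; assumption.
  - intros t Ht; rewrite Cmod_mult.
    apply Rmult_le_compat; try apply Cmod_ge_0.
    + apply Cmod_weighted_le_const; assumption.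
    + apply Cmod_Cpower_le; [unfold disk in Hz; lra | | lra].
      apply Re_one_sub_mul_ge, Ht.
  - intros t Ht; unfold weighted.
    rewrite vanishing_power_pos, Cpower_opp by lra.
    unfold Cdiv; ring.
Qed.

Definition Hilbert_deriv (b : R) (f : C -> C) (z : C) : C :=
  Cint (fun t => RtoC ((b + 1) * t) * weighted b f t
                 * Cpower (1 - t * z) (- (b + 2)))%C.

Lemma is_derive_Hilbert_op b f M z :
  0 < b -> analytic_on_disk f -> disk_bounded f M -> disk z ->
  is_derive (K := C_AbsRing) (V := C_NormedModule)
    (Hilbert_op b f) z (Hilbert_deriv b f z).
Proof.
  intros Hb Ha Hf Hz.
  apply (is_derive_ext_loc (K := C_AbsRing) (V := C_NormedModule)
    (fun z => Cint (fun t => weighted b f t * Cpower (1 - t * z) (- (b + 1)))%C)).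
  { apply filter_imp with (2 := locally_disk z Hz); intros y Hy.
    symmetry; apply Hilbert_op_eq_Cint with M; assumption. }
  unfold Hilbert_deriv.
  pose proof (is_derive_Cint_kernel (weighted b f) M (- (b + 1)) z) as H.
  replace (- - (b + 1)) with (b + 1) in H by ring.
  replace (- (b + 1) - 1) with (- (b + 2)) in H by ring.
  apply H; [| | lra | exact Hz].
  - intros t Ht; apply continuous_weighted with M; assumption.
  - intros t Ht; apply Cmod_weighted_le_const; assumption.
Qed.

Lemma Hilbert_deriv_correct b f M z :
  0 < b -> analytic_on_disk f -> disk_bounded f M -> disk z ->
  is_Cint (fun t => RtoC ((b + 1) * t) * weighted b f t
                    * Cpower (1 - t * z) (- (b + 2)))%C (Hilbert_deriv b f z).
Proof.
  intros Hb Ha Hf Hz; apply Cint_correct; intros t Ht.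
  apply continuous_Cmult_RC; [apply continuous_Cmult_RC|].
  - apply continuous_RC; unfold Re, Im; simpl; [|apply continuous_const].
    apply (ex_derive_continuous (fun t => (b + 1) * t)); auto_derive; exact I.
  - apply continuous_weighted with M; assumption.
  - apply continuous_Cpower_kernel; assumption.
Qed.

(** From [t <= 1] and [|1-tz| >= 1-t|z|], the integrand is dominated by
    [M (b+1)] times the one integrated in [is_RInt_weight]. *)
Lemma Cmod_Hilbert_deriv_le b f M z :
  0 < b -> analytic_on_disk f -> disk_bounded f M -> disk z ->
  Cmod (Hilbert_deriv b f z) <= M / (1 - Cmod z).
Proof.
  intros Hb Ha Hf Hz; set (r := Cmod z).
  assert (Hr : 0 <= r < 1) by (split; [apply Cmod_ge_0 | exact Hz]).
  pose proof (disk_bounded_ge0 f M Hf) as HM.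
  replace (M / (1 - r)) with (M * (b + 1) * / ((b + 1) * (1 - r)))
    by (field; lra).
  apply Cmod_is_Cint_le with
    (2 := Hilbert_deriv_correct b f M z Hb Ha Hf Hz)
    (3 := is_RInt_scal _ 0 1 (M * (b + 1)) _ (is_RInt_weight b r Hb Hr)).
  intros t Ht; change scal with Rmult; simpl.
  rewrite !Cmod_mult, Cmod_R, Rabs_pos_eq by nra.
  assert (HK : Cmod (Cpower (1 - t * z) (- (b + 2))) <=
               Rpower (1 - t * r) (- (b + 2))).
  { rewrite Cmod_Cpower; apply Rpower_le_base_neg; [|lra].
    split; [apply one_sub_mul_pos; assumption|].
    pose proof (Cmod_triangle (1 - t * z) (t * z)) as H.
    replace (1 - t * z + t * z)%C with (RtoC 1) in H by ring.
    rewrite Cmod_1, Cmod_mult, Cmod_R, Rabs_pos_eq in H by lra; fold r in H; lra. }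
  pose proof (Cmod_weighted_le b f M t Hf ltac:(lra)) as HW.
  pose proof (vanishing_power_ge0 (1 - t) b) as HV.
  pose proof (Cmod_ge_0 (weighted b f t)).
  pose proof (Cmod_ge_0 (Cpower (1 - t * z) (- (b + 2)))).
  replace (M * (b + 1) * (vanishing_power (1 - t) b * Rpower (1 - t * r) (- (b + 2))))
    with ((b + 1) * (M * vanishing_power (1 - t) b) * Rpower (1 - t * r) (- (b + 2)))
    by ring.
  apply Rmult_le_compat; [| assumption | | assumption].
  - apply Rmult_le_pos; [nra|assumption].
  - apply Rmult_le_compat; try assumption; nra.
Qed.

Lemma is_RInt_vanishing_power b :
  0 < b -> is_RInt (fun t => vanishing_power (1 - t) b) 0 1 (/ (b + 1)).
Proof.
  intros Hb; pose proof (is_RInt_weight b 0 Hb ltac:(lra)) as H.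
  rewrite Rminus_0_r, Rmult_1_r in H.
  apply is_RInt_ext with (2 := H); intros t _.
  rewrite Rmult_0_r, Rminus_0_r; unfold Rpower; rewrite ln_1, Rmult_0_r, exp_0.
  apply Rmult_1_r.
Qed.

Lemma is_Cint_Hilbert_op_0 b f M :
  0 < b -> analytic_on_disk f -> disk_bounded f M ->
  is_Cint (weighted b f) (Hilbert_op b f 0).
Proof.
  intros Hb Ha Hf.
  assert (E : forall t, 0 <= t <= 1 ->
    (weighted b f t * Cpower (1 - t * 0) (- (b + 1)))%C = weighted b f t).
  { intros t Ht.
    replace (1 - t * 0)%C with (RtoC 1) by ring.
    rewrite Cpower_RtoC by lra.
    unfold Rpower; rewrite ln_1, Rmult_0_r, exp_0; ring. }
  assert (Hd : disk 0) by (apply disk_RtoC; lra).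
  rewrite (Hilbert_op_eq_Cint b f M 0 Hb Ha Hf Hd).
  apply (is_RInt_ext (V := C_R_NormedModule)
    (fun t => weighted b f t * Cpower (1 - t * 0) (- (b + 1)))%C).
  { intros t; rewrite Rmin_left, Rmax_right by lra; intros Ht; apply E; lra. }
  apply Cint_correct; intros t Ht; apply continuous_Cmult_RC.
  - apply continuous_weighted with M; assumption.
  - apply continuous_Cpower_kernel; assumption.
Qed.

Lemma Cmod_Hilbert_op_0_le b f M :
  0 < b -> analytic_on_disk f -> disk_bounded f M ->
  Cmod (Hilbert_op b f 0) <= M * (1 / (b + 1)).
Proof.
  intros Hb Ha Hf; unfold Rdiv; rewrite Rmult_1_l.
  apply Cmod_is_Cint_le with
    (2 := is_Cint_Hilbert_op_0 b f M Hb Ha Hf)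
    (3 := is_RInt_scal _ 0 1 M _ (is_RInt_vanishing_power b Hb)).
  intros t Ht; apply Cmod_weighted_le; [assumption|lra].
Qed.

Lemma Bloch_norm_Hilbert_op_le b f M :
  0 < b -> analytic_on_disk f -> disk_bounded f M ->
  Rbar_le (Bloch_norm (Hilbert_op b f)) (Finite (M * (1 / (b + 1) + 2))).
Proof.
  intros Hb Ha Hf; unfold Bloch_norm.
  rewrite Rmult_plus_distr_l.
  change (Finite (M * (1 / (b + 1)) + M * 2)) with
    (Rbar_plus (Finite (M * (1 / (b + 1)))) (Finite (M * 2))).
  apply Rbar_plus_le_compat.
  - apply Cmod_Hilbert_op_0_le; assumption.
  - apply Lub_Rbar_correct; intros x [z [Hz ->]].
    rewrite (is_C_derive_unique _ _ _ (is_derive_Hilbert_op b f M z Hb Ha Hf Hz)).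
    pose proof (Cmod_Hilbert_deriv_le b f M z Hb Ha Hf Hz) as H.
    pose proof (disk_bounded_ge0 f M Hf); pose proof (Cmod_ge_0 z).
    unfold disk in Hz; simpl Rbar_le.
    apply Rle_trans with ((1 - Cmod z ^ 2) * (M / (1 - Cmod z))).
    + apply Rmult_le_compat_l; [nra|exact H].
    + replace ((1 - Cmod z ^ 2) * (M / (1 - Cmod z))) with (M * (1 + Cmod z))
        by (field; lra).
      apply Rmult_le_compat_l; lra.
Qed.

Lemma Hinf_bounded f : Hinf f -> exists M, disk_bounded f M.
Proof.
  intros [_ H]; unfold Hinf_norm in H.
  destruct (Lub_Rbar_correct (fun x => exists z, disk z /\ x = Cmod (f z)))
    as [Hub _].
  destruct (Lub_Rbar _) as [M| |].
  - exists M; intros z Hz; apply (Hub (Cmod (f z))); exists z; auto.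
  - destruct H.
  - exists 0; intros z Hz; destruct (Hub (Cmod (f z))); exists z; auto.
Qed.

Lemma Hinf_norm_le_bounded f M :
  Rbar_le (Hinf_norm f) (Finite M) <-> disk_bounded f M.
Proof.
  destruct (Lub_Rbar_correct (fun x => exists z, disk z /\ x = Cmod (f z)))
    as [Hub Hlub].
  split.
  - intros H z Hz.
    apply (Rbar_le_trans (Finite (Cmod (f z))) (Hinf_norm f) (Finite M)); [|exact H].
    apply Hub; exists z; auto.
  - intros H; apply Hlub; intros x [z [Hz ->]]; exact (H z Hz).
Qed.

Lemma analytic_one : analytic_on_disk (fun _ => RtoC 1).
Proof. intros z _; apply (ex_derive_const (K := C_AbsRing)). Qed.

Lemma disk_bounded_one : disk_bounded (fun _ => RtoC 1) 1.
Proof. intros z _; rewrite Cmod_1; lra. Qed.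

Lemma Re_Hilbert_op_one_0 b :
  0 < b -> Re (Hilbert_op b (fun _ => RtoC 1) 0) = 1 / (b + 1).
Proof.
  intros Hb.
  pose proof (is_Cint_Re _ _
    (is_Cint_Hilbert_op_0 b _ 1 Hb analytic_one disk_bounded_one)) as H.
  rewrite <- (is_RInt_unique (V := R_CompleteNormedModule) _ _ _ _ H).
  unfold Rdiv; rewrite Rmult_1_l.
  rewrite <- (is_RInt_unique (V := R_CompleteNormedModule) _ _ _ _
    (is_RInt_vanishing_power b Hb)).
  apply RInt_ext; intros t _; unfold weighted, Re; simpl; ring.
Qed.

(** Where [t >= 1-s] the first term alone is enough.  Elsewhere [1-t > s], and
    [(1-t)^(b+1) <= (1-tr)^(b+1)] bounds [(1-t)] times the weight by
    [1/(1-tr) <= 1/s]. *)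
Lemma weight_lower_bound b r s t :
  0 < b -> 0 <= r < 1 -> 0 < s -> 0 < t < 1 ->
  (1 - s) * (vanishing_power (1 - t) b * Rpower (1 - t * r) (- (b + 2))) - / s <=
  t * (vanishing_power (1 - t) b * Rpower (1 - t * r) (- (b + 2))).
Proof.
  intros Hb Hr Hs Ht.
  assert (Hpos : 0 < 1 - t * r) by (apply one_sub_mul_pos; lra).
  pose proof (vanishing_power_ge0 (1 - t) b) as HV.
  assert (HR : 0 < Rpower (1 - t * r) (- (b + 2))) by apply exp_pos.
  pose proof (Rinv_0_lt_compat s Hs).
  set (P := vanishing_power (1 - t) b * Rpower (1 - t * r) (- (b + 2))).
  assert (HP : 0 <= P) by (unfold P; apply Rmult_le_pos; lra).
  destruct (Rle_dec (1 - t) s) as [Hle|Hgt]; [nra|].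
  assert (Htail : (1 - t) * P <= / s).
  { unfold P; rewrite <- Rmult_assoc, <- vanishing_power_succ by lra.
    rewrite vanishing_power_pos by lra.
    apply Rle_trans with
      (Rpower (1 - t * r) (b + 1) * Rpower (1 - t * r) (- (b + 2))).
    - apply Rmult_le_compat_r; [lra|]; apply Rle_Rpower_l; nra.
    - rewrite <- Rpower_plus.
      replace (b + 1 + - (b + 2)) with (- (1)) by ring.
      rewrite Rpower_Ropp, Rpower_1 by exact Hpos.
      apply Rinv_le_contravar; nra. }
  nra.
Qed.

Lemma Re_Hilbert_deriv_one_ge b s :
  0 < b -> 0 < s < 1 ->
  (1 - s) / s ^ 2 - (b + 1) / s <=
    Re (Hilbert_deriv b (fun _ => RtoC 1) (RtoC (1 - s ^ 2))).
Proof.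
  intros Hb Hs; set (r := 1 - s ^ 2).
  assert (Hr : 0 <= r < 1) by (unfold r; nra).
  assert (Hd : disk (RtoC r)) by (apply disk_RtoC; lra).
  pose proof (is_Cint_Re _ _
    (Hilbert_deriv_correct b _ 1 _ Hb analytic_one disk_bounded_one Hd)) as HI.
  pose proof (is_RInt_minus _ _ 0 1 _ _
    (is_RInt_scal _ 0 1 ((b + 1) * (1 - s)) _ (is_RInt_weight b r Hb Hr))
    (is_RInt_const (V := R_NormedModule) 0 1 ((b + 1) / s))) as HL.
  refine (Rle_trans _ _ _ _ (is_RInt_le _ _ 0 1 _ _ Rle_0_1 HL HI _)).
  - right; unfold minus, plus, opp, scal; simpl; unfold mult; simpl.
    unfold r; field; nra.
  - intros t Ht.
    pose proof (weight_lower_bound b r s t Hb Hr ltac:(lra) Ht) as HW.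
    assert (Hpos : 0 < 1 - t * r) by (apply one_sub_mul_pos; lra).
    rewrite <- RtoC_mult, <- RtoC_minus, Cpower_RtoC by exact Hpos.
    unfold weighted, Re, minus, plus, opp, scal; simpl; unfold mult; simpl.
    unfold Rdiv; nra.
Qed.

(** The parameter [s] measures the distance to the boundary through
    [|z| = 1 - s^2]: the tail term [1/s] of [weight_lower_bound] is then
    negligible against [1/(1-|z|) = 1/s^2]. *)
Lemma Hilbert_op_one_seminorm_ge b s :
  0 < b -> 0 < s < 1 ->
  exists z, disk z /\
    2 - (2 * b + 5) * s <=
      (1 - Cmod z ^ 2) * Cmod (C_derive (Hilbert_op b (fun _ => RtoC 1)) z).
Proof.
  intros Hb Hs; exists (RtoC (1 - s ^ 2)).
  assert (Hd : disk (RtoC (1 - s ^ 2))) by (apply disk_RtoC; nra).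
  split; [exact Hd|].
  rewrite (is_C_derive_unique _ _ _
    (is_derive_Hilbert_op b _ 1 _ Hb analytic_one disk_bounded_one Hd)).
  rewrite Cmod_R, Rabs_pos_eq by nra.
  set (D := Hilbert_deriv _ _ _).
  assert (HD : (1 - s) / s ^ 2 - (b + 1) / s <= Cmod D).
  { apply Rle_trans with (1 := Re_Hilbert_deriv_one_ge b s Hb Hs).
    pose proof (re_le_Cmod D); pose proof (Rle_abs (Re D)); unfold D in *; lra. }
  apply Rle_trans with
    ((1 - (1 - s ^ 2) ^ 2) * ((1 - s) / s ^ 2 - (b + 1) / s)).
  - replace ((1 - (1 - s ^ 2) ^ 2) * ((1 - s) / s ^ 2 - (b + 1) / s)) with
      ((2 - s ^ 2) * (1 - (b + 2) * s)) by (field; lra).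
    assert (0 < s ^ 2 < s) by (split; nra).
    assert (0 < s * s ^ 2) by nra; nra.
  - apply Rmult_le_compat_l; [|exact HD].
    replace (1 - (1 - s ^ 2) ^ 2) with (s ^ 2 * (2 - s ^ 2)) by ring.
    apply Rmult_le_pos; nra.
Qed.

Lemma Bloch_norm_Hilbert_op_one_ge b :
  0 < b ->
  Rbar_le (Finite (1 / (b + 1) + 2))
    (Bloch_norm (Hilbert_op b (fun _ => RtoC 1))).
Proof.
  intros Hb; unfold Bloch_norm.
  change (Finite (1 / (b + 1) + 2)) with
    (Rbar_plus (Finite (1 / (b + 1))) (Finite 2)).
  apply Rbar_plus_le_compat.
  - simpl; rewrite <- (Re_Hilbert_op_one_0 b Hb).
    apply Rle_trans with (1 := Rle_abs _); apply re_le_Cmod.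
  - match goal with |- Rbar_le _ (Lub_Rbar ?S) => set (E := S) end.
    destruct (Lub_Rbar_correct E) as [Hub _].
    assert (Hs : forall s, 0 < s < 1 ->
              Rbar_le (Finite (2 - (2 * b + 5) * s)) (Lub_Rbar E)).
    { intros s Hs; destruct (Hilbert_op_one_seminorm_ge b s Hb Hs) as [z [Hz Hle]].
      refine (Rbar_le_trans (Finite _) (Finite _) _ Hle _).
      apply Hub; exists z; auto. }
    destruct (Lub_Rbar E) as [L| |]; simpl in *; [|exact I|].
    + apply Rnot_lt_le; intros HL.
      (* Small enough that the loss [(2b+5)s] is at most half the gap [2-L]. *)
      set (s := Rmin (/ 2) ((2 - L) / (2 * (2 * b + 5)))).
      assert (Hpos : 0 < (2 - L) / (2 * (2 * b + 5))).
      { apply Rdiv_lt_0_compat; lra. }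
      assert (Hs0 : 0 < s < 1).
      { unfold s; split; [apply Rmin_pos; lra|].
        pose proof (Rmin_l (/ 2) ((2 - L) / (2 * (2 * b + 5)))); lra. }
      pose proof (Rmin_r (/ 2) ((2 - L) / (2 * (2 * b + 5)))) as Hr; fold s in Hr.
      assert ((2 * b + 5) * s <= (2 - L) / 2).
      { replace ((2 - L) / 2) with ((2 * b + 5) * ((2 - L) / (2 * (2 * b + 5))))
          by (field; lra).
        apply Rmult_le_compat_l; lra. }
      pose proof (Hs s Hs0); lra.
    + apply (Hs (/ 2)); lra.
Qed.

Theorem theorem1p3 (b : R) (hb : 0 < b) :
  (forall f : C -> C, Hinf f -> Bloch (Hilbert_op b f)) /\
  operator_norm Hinf Hinf_norm Bloch_norm (Hilbert_op b)
    = Finite (1 / (b + 1) + 2).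
Proof.
  split.
  - intros f Hf; destruct (Hinf_bounded f Hf) as [M HM]; destruct Hf as [Ha _].
    split.
    + intros z Hz; eexists; apply is_derive_Hilbert_op with M; assumption.
    + exact (Rbar_le_lt_trans _ _ p_infty (Bloch_norm_Hilbert_op_le b f M hb Ha HM) I).
  - apply Rbar_is_lub_unique; split.
    + intros y [f [[Ha _] [Hf ->]]].
      apply Hinf_norm_le_bounded in Hf.
      rewrite <- (Rmult_1_l (1 / (b + 1) + 2)).
      apply Bloch_norm_Hilbert_op_le; assumption.
    + intros u Hu.
      refine (Rbar_le_trans _ _ _ (Bloch_norm_Hilbert_op_one_ge b hb) _).
      apply Hu; exists (fun _ => RtoC 1).
      assert (H1 : Rbar_le (Hinf_norm (fun _ => RtoC 1)) (Finite 1))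
        by apply Hinf_norm_le_bounded, disk_bounded_one.
      split; [split; [apply analytic_one|] | split; [exact H1|reflexivity]].
      exact (Rbar_le_lt_trans _ _ p_infty H1 I).
Qed.
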